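(* For every $C>1$ there exists $b_0>0$ such that for every $b>b_0$ and every $k\ge Cb/\ln b$, the mixing time and the relaxation time of the heat-bath Glauber dynamics for proper $k$-colorings of the star graph $G^*$ are $O(b\ln b)$.
   Context: $G^*$ is the star graph on $b+1$ vertices: a root $r$ adjacent to $b$ leaves. A proper $k$-coloring assigns colors from $\{1,\dots,k\}$ so adjacent vertices get distinct colors. The heat-bath Glauber dynamics picks a uniformly random vertex and recolors it uniformly among colors not used by its neighbors. Mixing time: $\min\{t:\max_\sigma\|P^t(\sigma,\cdot)-\pi\|_{TV}\le 1/(2e)\}$ with $\pi$ uniform on proper colorings; relaxation time: $1/(1-\lambda)$ with $\lambda$ the second largest eigenvalue in absolute value of the transition matrix. *)

(* Defs.v *)
From HB Require Import structures.
From mathcomp Require Import all_boot all_order all_algebra.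
From mathcomp Require Import all_classical all_reals all_analysis.
Set Implicit Arguments. Unset Strict Implicit. Unset Printing Implicit Defensive.
Import Order.TTheory GRing.Theory Num.Theory.
Local Open Scope ring_scope.

(** A simple graph on a finite vertex type [V] is given by a symmetric
    irreflexive relation [adj]. *)

Definition star_adj (b : nat) : rel 'I_b.+1 :=
  fun u v => (u == ord0) != (v == ord0).

Definition proper (V : finType) (adj : rel V) (k : nat) (c : {ffun V -> 'I_k}) : bool :=
  [forall u, [forall v, adj u v ==> (c u != c v)]].

Notation coloring adj k := {c : {ffun _ -> 'I_k} | proper adj c}.

Definition allowed (V : finType) (adj : rel V) (k : nat) (c : {ffun V -> 'I_k}) (v : V)
  : {set 'I_k} := [set a | [forall u, adj v u ==> (c u != a)]].

Definition glauber (R : realType) (V : finType) (adj : rel V) (k : nat)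
  (s t : coloring adj k) : R :=
  (#|V|%:R)^-1 * \sum_(v : V)
     (if [forall u, (u != v) ==> (val s u == val t u)] && (val t v \in allowed adj (val s) v)
      then (#|allowed adj (val s) v|%:R)^-1 else 0).

Definition glauber_mx (R : realType) (V : finType) (adj : rel V) (k : nat)
  : 'M[R]_#|{: coloring adj k}| :=
  \matrix_(i, j) glauber R (enum_val i) (enum_val j).

Definition mxpow (R : realType) (n : nat) (P : 'M[R]_n) (t : nat) : 'M[R]_n :=
  iter t (fun A => A *m P) 1%:M.

Definition dist_tv (R : realType) (n : nat) (P : 'M[R]_n) (t : nat) : R :=
  \big[Num.max/0]_(i < n)
     (2^-1 * \sum_(j < n) `|mxpow P t i j - (n%:R)^-1|).

Definition mixing_time (R : realType) (n : nat) (P : 'M[R]_n) : \bar R :=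
  match pselect (exists t, dist_tv P t <= (2 * expR 1)^-1) with
  | left h => ((@ex_minn (fun t => dist_tv P t <= (2 * expR 1)^-1) h)%:R)%:E
  | right _ => +oo%E
  end.

(** lambda_* : second largest eigenvalue in absolute value, i.e. the largest
    |mu| over eigenvalues mu <> 1, together with mu = 1 if the eigenvalue 1
    is repeated (eigenspace of dimension >= 2). *)
Definition lambda_star (R : realType) (n : nat) (P : 'M[R]_n) : R :=
  sup [set `|mu| | mu in [set mu : R | eigenvalue P mu &&
                                       ((mu != 1) || (1 < \rank (eigenspace P 1))%N)]]%classic.

Definition relaxation_time (R : realType) (n : nat) (P : 'M[R]_n) : \bar R :=
  if lambda_star P < 1 then ((1 - lambda_star P)^-1)%:E else +oo%E.

(* Main.v *)
(** Run two copies x, y of the dynamics with y stationary, updating the same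
    vertex in both with a maximal coupling of the new colors, and track the
    Hamming distance in which the root has weight W = 1 + 2b/(k-1) and every
    leaf weight 1.  A root disagreement spreads to a given leaf with probability
    1/(k-1), and h leaf disagreements spread to the root with probability at most
    h/|A|, where A is the set of colors available to the root in y.  So if
    |A| >= 2W the weighted distance contracts by 1 - 1/(2(b+1)) on average, and
    otherwise it grows by at most W/(b+1) in addition.  Only the stationary copy
    has to have many available colors, so no burn-in is needed: if p is the
    stationary probability of |A| < 2W, the total variation distance after t steps
    is at most (1 - 1/(2(b+1)))^t (b + W) + 2Wp.  Under the uniform measure |A| - 1
    has mean mu = (k-1)(1 - 1/(k-1))^b and variance at most mu; for
    k >= C b / ln b with C > 1, mu is at least a positive power of b (up to
    logarithms) while W = O(ln b), so Chebyshev makes Wp small. *)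
Require Import Defs.
From HB Require Import structures.
From mathcomp Require Import all_boot all_order all_algebra.
From mathcomp Require Import all_classical all_reals all_analysis.
From mathcomp Require Import ring lra.
Set Implicit Arguments. Unset Strict Implicit. Unset Printing Implicit Defensive.
Import Order.TTheory GRing.Theory Num.Theory.
Local Open Scope ring_scope.

(** * Maximal couplings and averages over finite sets *)

(** The common mass [Num.min (p a) (q a)] is put on the diagonal, and the two residual masses, both
    of total [d], are coupled as a normalized product. *)
Lemma maximal_coupling (R : realFieldType) (T : finType) (p q : T -> R) :
  (forall a, 0 <= p a) -> (forall a, 0 <= q a) ->
  \sum_a p a = 1 -> \sum_a q a = 1 ->
  exists c : T -> T -> R,
    [/\ forall a b, 0 <= c a b,
        forall a, \sum_b c a b = p a,
        forall b, \sum_a c a b = q b &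
        \sum_a \sum_b c a b * (a != b)%:R <= 1 - \sum_a Num.min (p a) (q a)].
Proof.
move=> p0 q0 p1 q1.
pose m a := Num.min (p a) (q a); pose d := 1 - \sum_a m a.
pose rp a := p a - m a; pose rq a := q a - m a.
have rp0 a : 0 <= rp a by rewrite subr_ge0 ge_min lexx.
have rq0 a : 0 <= rq a by rewrite subr_ge0 ge_min lexx orbT.
have srp : \sum_a rp a = d by rewrite sumrB p1.
have srq : \sum_a rq a = d by rewrite sumrB q1.
have m0 a : 0 <= m a by rewrite le_min p0 q0.
have d0 : 0 <= d by rewrite -srp sumr_ge0.
(* If [d = 0] then [d / d] is 0, but all residual masses vanish as well. *)
have drp a : rp a * (d / d) = rp a.
  have [dz|dn] := eqVneq d 0; last by rewrite divff ?mulr1.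
  rewrite dz mul0r mulr0; apply/esym/eqP.
  by move: srp; rewrite dz => /eqP; rewrite psumr_eq0 // => /allP/(_ a); rewrite mem_index_enum => /(_ isT).
have drq a : rq a * (d / d) = rq a.
  have [dz|dn] := eqVneq d 0; last by rewrite divff ?mulr1.
  rewrite dz mul0r mulr0; apply/esym/eqP.
  by move: srq; rewrite dz => /eqP; rewrite psumr_eq0 // => /allP/(_ a); rewrite mem_index_enum => /(_ isT).
exists (fun a b => m a * (a == b)%:R + rp a * rq b / d); split.
- by move=> a b; rewrite addr_ge0 ?divr_ge0 ?mulr_ge0.
- move=> a; rewrite big_split /= -mulr_suml -mulr_sumr srq -mulrA drp.
  rewrite (bigD1 a) //= eqxx mulr1 big1 ?addr0 ?subrKC //.
  by move=> b /negPf; rewrite eq_sym => ->; rewrite mulr0.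
- move=> b; rewrite big_split /= -!mulr_suml srp [d * _]mulrC -mulrA drq.
  rewrite (bigD1 b) //= eqxx mulr1 big1 ?addr0 ?subrKC //.
  by move=> a /negPf->; rewrite mulr0.
- rewrite -/d; apply: (@le_trans _ _ (\sum_a \sum_b rp a * rq b / d)).
    apply: ler_sum => a _; apply: ler_sum => b _.
    case: eqVneq => _ /=; rewrite ?mulr0 ?mulr1 ?add0r //.
    by rewrite divr_ge0 ?mulr_ge0.
  under eq_bigr do rewrite -mulr_suml -mulr_sumr srq -mulrA drp.
  by rewrite srp.
Qed.

Lemma natr_card (R : pzSemiRingType) (T : finType) (A : {pred T}) :
  \sum_a (a \in A)%:R = #|A|%:R :> R.
Proof. by rewrite -natr_sum -big_mkcond sum1_card. Qed.

Definition avg {R : realFieldType} {T : finType} (A : {set T}) (u : T -> R) : R :=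
  #|A|%:R^-1 * \sum_(a in A) u a.

(** The uniform laws on [A] and [B] are compared through a maximal coupling. The error [e] sees only
    the second coordinate, so it is integrated against the marginal on [B], whatever the
    coupling. *)
Lemma avg_coupling (R : realFieldType) (T : finType) (A B : {set T})
  (u w e : T -> R) (c0 c1 : R) (M : nat) :
  (0 < #|A|)%N -> (0 < #|B|)%N -> 0 <= c1 ->
  (#|A :\: B| <= M)%N -> (#|B :\: A| <= M)%N ->
  (forall a b, a \in A -> b \in B -> `|u a - w b| <= c0 + c1 * (a != b)%:R + e b) ->
  `|avg A u - avg B w| <= c0 + c1 * Num.min 1 (M%:R / #|B|%:R) + avg B e.
Proof.
move=> A0 B0 c10 AB BA H.
have A0' : (0 : R) < #|A|%:R by rewrite ltr0n.
have B0' : (0 : R) < #|B|%:R by rewrite ltr0n.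
pose p (X : {set T}) a : R := (a \in X)%:R / #|X|%:R.
have p0 X a : 0 <= p X a by rewrite divr_ge0.
have pE X v : \sum_a p X a * v a = avg X v.
  rewrite /avg mulr_sumr [RHS]big_mkcond; apply: eq_bigr => a _; rewrite /p.
  by case: ifP => _; rewrite ?mul0r // mul1r.
have p1 (X : {set T}) : (0 < #|X|)%N -> \sum_a p X a = 1.
  move=> X0; rewrite -mulr_suml natr_card.
  by rewrite divff // pnatr_eq0 -lt0n.
have [c [cp cA cB cd]] := maximal_coupling (p0 A) (p0 B) (p1 _ A0) (p1 _ B0).
(* The hypothesis on [u] and [w] holds only on [A] times [B], where the coupling must therefore be
   supported. *)
have cs a b : ~~ ((a \in A) && (b \in B)) -> c a b = 0.
  rewrite negb_and => /orP[] /negPf ab.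
    have /eqP := cA a; rewrite /p ab mul0r psumr_eq0 // => /allP/(_ b).
    by rewrite mem_index_enum => /(_ isT)/eqP.
  have /eqP := cB b; rewrite /p ab mul0r psumr_eq0 // => /allP/(_ a).
  by rewrite mem_index_enum => /(_ isT)/eqP.
have dle : \sum_a \sum_b c a b * (a != b)%:R <= Num.min 1 (M%:R / #|B|%:R).
  apply: (le_trans cd); rewrite le_min; apply/andP; split.
    by rewrite gerBl sumr_ge0 // => a _; rewrite le_min !p0.
  rewrite lerBlDl -lerBlDr.
  have cI : \sum_a (a \in A :&: B)%:R = #|A :&: B|%:R :> R.
    exact: natr_card.
  (* The minima sum to [#|A :&: B|] over the larger cardinality. If [A] is larger, the defect
     [#|A :\: B| / #|A|] is still at most [M / #|B|], so only the size of [B] enters. *)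
  have [AleB|BltA] := leqP #|A| #|B|.
    apply: (@le_trans _ _ (#|A :&: B|%:R / #|B|%:R)).
      rewrite lerBlDr -mulrDl ler_pdivlMr // mul1r -natrD ler_nat.
      by rewrite -(cardsID A B) finset.setIC leq_add2l.
    rewrite -cI mulr_suml; apply: ler_sum => a _.
    rewrite /p inE; case: (a \in A); case: (a \in B); rewrite /= ?mul0r ?le_min ?lexx ?andbT ?divr_ge0 //.
    by rewrite ler_pM2l // lef_pV2 ?posrE // ler_nat.
  apply: (@le_trans _ _ (#|A :&: B|%:R / #|A|%:R)).
    rewrite lerBlDr -(@ler_pM2r _ #|A|%:R) // mul1r mulrDl divfK ?gt_eqF //.
    rewrite -{1}(cardsID B A) natrD lerD2l.
    apply: (@le_trans _ _ M%:R); first by rewrite ler_nat.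
    rewrite mulrAC -mulrA ler_peMr // ler_pdivlMr // mul1r ler_nat.
    exact: ltnW.
  rewrite -cI mulr_suml; apply: ler_sum => a _.
  rewrite /p inE; case: (a \in A); case: (a \in B); rewrite /= ?mul0r ?le_min ?lexx ?andbT ?divr_ge0 //=.
  by rewrite ler_pM2l // lef_pV2 ?posrE // ler_nat ltnW.
have -> : avg A u - avg B w = \sum_a \sum_b c a b * (u a - w b).
  rewrite -!pE; under [X in _ = X]eq_bigr do under eq_bigr do rewrite mulrBr.
  under [X in _ = X]eq_bigr do rewrite sumrB -mulr_suml cA.
  rewrite sumrB; congr (_ - _); rewrite exchange_big /=.
  by apply: eq_bigr => b _; rewrite -mulr_suml cB.
apply: (@le_trans _ _ (\sum_a \sum_b c a b * (c0 + c1 * (a != b)%:R + e b))).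
  apply: (le_trans (ler_norm_sum _ _ _)); apply: ler_sum => a _.
  apply: (le_trans (ler_norm_sum _ _ _)); apply: ler_sum => b _.
  have [/andP[aA bB]|/cs ->] := boolP ((a \in A) && (b \in B)); last by rewrite !mul0r normr0.
  by rewrite normrM ger0_norm // ler_wpM2l // H.
have -> : \sum_a \sum_b c a b * (c0 + c1 * (a != b)%:R + e b) =
   c0 + c1 * (\sum_a \sum_b c a b * (a != b)%:R) + avg B e.
  under eq_bigr do under eq_bigr do rewrite !mulrDr mulrCA.
  under eq_bigr do rewrite !big_split /= -mulr_suml cA -mulr_sumr.
  rewrite !big_split /= -mulr_suml p1 // mul1r -mulr_sumr; congr (_ + _).
  rewrite -pE exchange_big /=; apply: eq_bigr => b _.
  by rewrite -mulr_suml cB.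
by rewrite lerD2r lerD2l ler_wpM2l.
Qed.

(** * The heat-bath dynamics as an operator on test functions *)

Definition recolor {V : finType} {k : nat} (c : {ffun V -> 'I_k}) v a : {ffun V -> 'I_k} :=
  [ffun u => if u == v then a else c u].

(** The transition operator on observables, defined on all colorings so that iterating it carries no
    properness proofs. *)
Definition heat_bath (R : realType) (V : finType) (adj : rel V) (k : nat)
  (g : {ffun V -> 'I_k} -> R) (c : {ffun V -> 'I_k}) : R :=
  #|V|%:R^-1 * \sum_v avg (allowed adj c v) (fun a => g (recolor c v a)).

Definition wdist {R : realType} {V : finType} {T : eqType} (w : V -> R) (x y : {ffun V -> T}) : R :=
  \sum_v w v * (x v != y v)%:R.

Section HeatBath.
Context (R : realType) (V : finType) (adj : rel V) (k : nat).
Hypothesis adj_irr : irreflexive adj.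
Hypothesis adj_sym : symmetric adj.
Implicit Types (c x y : {ffun V -> 'I_k}) (g e : {ffun V -> 'I_k} -> R) (w : V -> R).

Local Notation T := (@heat_bath R V adj k).
Local Notation isp := (@Defs.proper V adj k).

Lemma proper_coloringP c : reflect (forall u v, adj u v -> c u != c v) (isp c).
Proof.
apply: (iffP forallP) => H u; last by apply/forallP => v; apply/implyP/H.
by move=> v uv; move/forallP: (H u) => /(_ v)/implyP; apply.
Qed.

Lemma allowedP c v a : reflect (forall u, adj v u -> c u != a) (a \in allowed adj c v).
Proof.
rewrite inE; apply: (iffP forallP) => H u; first by move/implyP: (H u).
by apply/implyP/H.
Qed.

Lemma proper_allowed c v : isp c -> c v \in allowed adj c v.
Proof. by move/proper_coloringP => H; apply/allowedP => u; rewrite adj_sym; apply: H. Qed.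

Lemma card_allowed_gt0 c v : isp c -> (0 < #|allowed adj c v|)%N.
Proof. by move=> H; apply/card_gt0P; exists (c v); apply: proper_allowed. Qed.

Lemma proper_recolor c v a : isp c -> a \in allowed adj c v -> isp (recolor c v a).
Proof.
move=> /proper_coloringP H /allowedP A; apply/proper_coloringP => u u' uu'; rewrite !ffunE.
case: (eqVneq u v) uu' => [->|uv] uu'; case: (eqVneq u' v) uu' => [->|u'v] uu'.
- by rewrite adj_irr in uu'.
- by rewrite eq_sym A.
- by rewrite A // adj_sym.
- exact: H.
Qed.

(** A color available in [x] but blocked in [y] is the [y]-color of some neighbor at which [x] and
    [y] disagree. *)
Lemma card_allowedD x y v :
  (#|allowed adj x v :\: allowed adj y v| <= \sum_(u | adj v u) (x u != y u))%N.
Proof.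
apply: (@leq_trans #|[set y u | u in [set u | adj v u && (x u != y u)]]|).
  apply/subset_leq_card/fintype.subsetP => a; rewrite inE => /andP[aY /allowedP aX].
  move: aY; rewrite inE negb_forall => /existsP[u].
  rewrite negb_imply negbK => /andP[vu /eqP yu].
  by apply/imsetP; exists u; rewrite ?inE ?yu ?vu ?aX.
apply: (leq_trans (leq_imset_card _ _)).
by rewrite -sum1dep_card big_mkcondr /=; apply: leq_sum => u _; case: ifP.
Qed.

Lemma wdist_recolor w x y v a b :
  wdist w (recolor x v a) (recolor y v b) =
  wdist w x y - w v * (x v != y v)%:R + w v * (a != b)%:R.
Proof.
rewrite /wdist (bigD1 v) //= [X in _ = X - _ + _](bigD1 v) //= !ffunE eqxx.
rewrite [X in _ = X - _ + _]addrC addrK addrC; congr (_ + _).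
by apply: eq_bigr => u /negPf uv; rewrite !ffunE uv.
Qed.

(* The coupled chains enter only through test functions: a one-step coupling of
   x and y turns the modulus [alpha * wdist w x y + e y] of g into that of [T g],
   the error e, which depends on y alone, being moved by the dynamics. *)
Lemma heat_bath_contract w g e (alpha : R) :
  (forall v, 0 <= w v) -> 0 <= alpha ->
  (forall x y, isp x -> isp y -> `|g x - g y| <= alpha * wdist w x y + e y) ->
  forall x y, isp x -> isp y ->
  `|T g x - T g y| <= alpha * (#|V|%:R^-1 * \sum_v (wdist w x y - w v * (x v != y v)%:R +
     w v * Num.min 1 ((\sum_(u | adj v u) (x u != y u))%:R / #|allowed adj y v|%:R))) + T e y.
Proof.
move=> w0 a0 H x y px py.
rewrite /heat_bath -mulrBr normrM ger0_norm ?invr_ge0 // mulrCA -mulrDr.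
rewrite ler_wpM2l ?invr_ge0 // -sumrB (le_trans (ler_norm_sum _ _ _)) //.
rewrite mulr_sumr -big_split; apply: ler_sum => v _ /=.
have := @avg_coupling R _ (allowed adj x v) (allowed adj y v)
  (fun a => g (recolor x v a)) (fun a => g (recolor y v a)) (fun a => e (recolor y v a))
  (alpha * (wdist w x y - w v * (x v != y v)%:R)) (alpha * w v)
  (\sum_(u | adj v u) (x u != y u))%N.
rewrite [X in _ -> _ <= X + _]mulrDr [X in _ -> _ <= _ + X + _]mulrA; apply; rewrite ?card_allowed_gt0 ?mulr_ge0 //.
- exact: card_allowedD.
- by under eq_bigr do rewrite eq_sym; exact: card_allowedD.
- move=> a b aX bY; apply: (le_trans (H _ _ (proper_recolor px aX) (proper_recolor py bY))).
  by rewrite wdist_recolor mulrDr mulrA.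
Qed.

Lemma sum_coloring (F : {ffun V -> 'I_k} -> R) :
  \sum_(t : coloring adj k) F (val t) = \sum_(c | isp c) F c.
Proof. by rewrite -big_sub. Qed.

Lemma glauber_heat_bath (s : coloring adj k) g :
  \sum_(t : coloring adj k) glauber R s t * g (val t) = T g (val s).
Proof.
rewrite /glauber /heat_bath; under eq_bigr do rewrite -mulrA mulr_suml.
rewrite -mulr_sumr; congr (_ * _); rewrite exchange_big /=; apply: eq_bigr => v _.
rewrite /avg mulr_sumr.
pose G c := (if [forall u, (u != v) ==> (val s u == c u)] && (c v \in allowed adj (val s) v)
   then #|allowed adj (val s) v|%:R^-1 else 0) * g c.
rewrite -[LHS]/(\sum_(t : coloring adj k) G (val t)) sum_coloring.
rewrite /G; under eq_bigr do rewrite (fun_if ( *%R^~ _)) mul0r.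
rewrite -big_mkcondr /=.
have recK a : recolor (val s) v a v = a by rewrite ffunE eqxx.
(* A coloring that agrees with [s] off [v] is determined by its color at [v]. *)
rewrite (reindex_onto (fun a => recolor (val s) v a) (fun c : {ffun V -> 'I_k} => c v)) /=; last first.
  move=> c /and3P[_ /forallP H _]; apply/ffunP => u; rewrite ffunE.
  by case: (eqVneq u v) => [->//|uv]; move: (H u); rewrite uv => /eqP.
apply: eq_bigl => a; rewrite recK eqxx andbT.
have [aA|] := boolP (a \in _); last by rewrite andbF andbF.
rewrite proper_recolor ?(valP s) //= andbT; apply/forallP => u.
by rewrite ffunE; apply/implyP => /negPf ->.
Qed.

(** Colorings that differ at most at [v] have the same colors available at [v]. This symmetry is
    reversibility for the uniform measure. *)
Lemma glauber_sym (s t : coloring adj k) : glauber R s t = glauber R t s.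
Proof.
rewrite /glauber; congr (_ * _); apply: eq_bigr => v _.
have -> : [forall u, (u != v) ==> (val t u == val s u)] =
          [forall u, (u != v) ==> (val s u == val t u)].
  by apply: eq_forallb => u; rewrite [val t u == _]eq_sym.
have [/forallP st|//] := boolP [forall u, (u != v) ==> (val s u == val t u)].
have -> : allowed adj (val t) v = allowed adj (val s) v.
  apply/finset.setP => a; rewrite !inE; apply: eq_forallb => u.
  case: (eqVneq u v) => [->|uv]; first by rewrite adj_irr.
  by move: (st u); rewrite uv => /eqP ->.
suff H : val t v \in allowed adj (val s) v.
  by rewrite /= H proper_allowed // (valP s).
apply/allowedP => u vu; case: (eqVneq u v) vu => [->|uv]; first by rewrite adj_irr.
move: (st u); rewrite uv => /eqP -> vu.
by move/proper_coloringP: (valP t); apply; rewrite adj_sym.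
Qed.

Lemma heat_bath_cst c (a : R) : (0 < #|V|)%N -> isp c -> T (fun=> a) c = a.
Proof.
move=> V0 pc; rewrite /heat_bath.
under eq_bigr => v _.
  rewrite /avg sumr_const -[a *+ _]mulr_natr mulrCA mulVf ?mulr1; last first.
    by rewrite pnatr_eq0 -lt0n card_allowed_gt0.
  over.
by rewrite sumr_const -[a *+ _]mulr_natl mulrA mulVf ?mul1r // pnatr_eq0 -lt0n.
Qed.

Lemma heat_bath_stationary g : (0 < #|V|)%N ->
  \sum_(c | isp c) T g c = \sum_(c | isp c) g c.
Proof.
move=> V0; rewrite -!sum_coloring.
under eq_bigr do rewrite -glauber_heat_bath.
rewrite exchange_big /=; apply: eq_bigr => t _.
rewrite -mulr_suml; under eq_bigr do rewrite glauber_sym -[glauber _ _ _]mulr1.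
by rewrite (glauber_heat_bath t (fun=> 1)) heat_bath_cst ?mul1r // (valP t).
Qed.

Lemma mxpow_heat_bath g t i :
  (mxpow (glauber_mx R adj k) t *m \col_j g (val (enum_val j))) i 0 =
  iter t T g (val (enum_val i)).
Proof.
elim: t g => [|t IH] g; first by rewrite /mxpow /= mul1mx mxE.
rewrite /mxpow iterS -mulmxA iterSr -IH; congr ((_ *m _) i 0).
apply/matrixP => j j'; rewrite !mxE -glauber_heat_bath.
under eq_bigr do rewrite !mxE.
by rewrite [RHS](reindex _ (onW_bij _ (enum_val_bij _))).
Qed.

Lemma glauber_mx_stochastic : (0 < #|V|)%N ->
  glauber_mx R adj k *m const_mx 1 = const_mx 1 :> 'cV_(#|{: coloring adj k}|).
Proof.
move=> V0; apply/matrixP => i j; rewrite [RHS]mxE -[RHS](heat_bath_cst 1 V0 (valP (enum_val i))).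
rewrite -glauber_heat_bath // mxE [RHS](reindex _ (onW_bij _ (enum_val_bij _))) /=.
by apply: eq_bigr => j' _; rewrite !mxE.
Qed.

End HeatBath.

(** * From contraction on average to total variation *)

Section Mixing.
Context (R : realType) (V : finType) (adj : rel V) (k : nat).
Hypothesis adj_irr : irreflexive adj.
Hypothesis adj_sym : symmetric adj.
Hypothesis V_gt0 : (0 < #|V|)%N.
Variables (w : V -> R) (W : R) (bad : pred {ffun V -> 'I_k}).
Hypothesis W_ge0 : 0 <= W.
Hypothesis w_ge1 : forall v, 1 <= w v.
Local Notation T := (@heat_bath R V adj k).
Local Notation isp := (@Defs.proper V adj k).
Local Notation rho := (1 - (2 * #|V|%:R)^-1 : R).
(** The left side bounds the expected weight of disagreement created by an update, summed over the
    updated vertex. *)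
Hypothesis drift : forall x y, isp x -> isp y ->
  \sum_v w v * Num.min 1 ((\sum_(u | adj v u) (x u != y u))%:R / #|allowed adj y v|%:R)
  <= wdist w x y / 2 + W * (bad y)%:R.

Let n0 : (#|V|%:R : R) != 0. Proof. by rewrite pnatr_eq0 -lt0n. Qed.

Lemma rho_ge0 : 0 <= rho.
Proof.
rewrite subr_ge0 invf_le1; last by rewrite mulr_gt0 ?ltr0n.
by rewrite -natrM ler1n muln_gt0.
Qed.

(* The sum of e telescopes because the dynamics preserves the uniform measure and
   each step adds [2 * rho ^+ t * (W / #|V|)] per bad coloring. *)
Lemma iter_heat_bath_contract g t : (forall c, `|g c| <= 1) ->
  exists e, (forall x y, isp x -> isp y ->
      `|iter t T g x - iter t T g y| <= 2 * rho ^+ t * wdist w x y + e y) /\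
    \sum_(c | isp c) e c = 2 * (1 - rho ^+ t) * (2 * W * #|[set c | isp c & bad c]|%:R).
Proof.
move=> g1; elim: t => [|t [e [He Se]]].
  exists (fun=> 0); split; last by rewrite big1 // expr0 subrr mulr0 mul0r.
  move=> x y px py; rewrite /= expr0 mulr1 addr0.
  have [->|xy] := eqVneq x y.
    by rewrite subrr normr0 mulr_ge0 // sumr_ge0 // => v _; rewrite mulr_ge0 // (le_trans _ (w_ge1 v)).
  (* Distinct colorings are at weighted distance at least 1, since every weight is at least 1. *)
  apply: (@le_trans _ _ 2).
    by rewrite (le_trans (ler_normB _ _)) // -[2]/(1 + 1) lerD.
  rewrite ler_peMr //.
  have /existsP[v xyv] : [exists v, x v != y v].
    rewrite -negb_forall; apply: contra xy => /forallP H; apply/eqP/ffunP => v.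
    exact/eqP.
  rewrite /wdist (bigD1 v) //= xyv mulr1 -[1]addr0 lerD // sumr_ge0 // => u _.
  by rewrite mulr_ge0 // (le_trans _ (w_ge1 u)).
have a0 : 0 <= 2 * rho ^+ t by rewrite mulr_ge0 // exprn_ge0 // rho_ge0.
exists (fun y => 2 * rho ^+ t * (#|V|%:R^-1 * W * (bad y)%:R) + T e y); split.
  move=> x y px py; rewrite !iterS.
  apply: (le_trans (heat_bath_contract adj_irr adj_sym _ a0 He px py)).
    by move=> v; rewrite (le_trans _ (w_ge1 v)).
  rewrite addrA lerD2r exprSr [2 * (_ * _)]mulrA -[X in _ <= X + _]mulrA -mulrDr ler_wpM2l //.
  (* Erasing the old disagreement at the updated vertex leaves [#|V| - 1] copies of [wdist w x y] in
     the sum over vertices; [drift] returns half a copy, whence [rho]. *)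
  rewrite big_split sumrB sumr_const -[wdist w x y *+ _]mulr_natl /= -/(wdist w x y).
  have -> : rho * wdist w x y + #|V|%:R^-1 * W * (bad y)%:R =
     #|V|%:R^-1 * (#|V|%:R * wdist w x y - wdist w x y + (wdist w x y / 2 + W * (bad y)%:R)).
    by field.
  by rewrite ler_wpM2l ?invr_ge0 // lerD2l drift.
rewrite big_split heat_bath_stationary // Se /= -!mulr_sumr exprSr.
have -> : \sum_(c | isp c) (bad c)%:R = #|[set c | isp c & bad c]|%:R :> R.
  by rewrite -sum1dep_card natr_sum big_mkcondr; apply: eq_bigr => c _; case: (bad c).
by field.
Qed.

(** By stationarity, the L1 distance is the uniform average over [c] of
    [iter t T g x - iter t T g c] for a suitable [g]. The modulus then applies with [c] as the
    stationary copy, and only the average of [e] matters. *)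
Lemma dist_tv_glauber t : (0 < #|{: coloring adj k}|)%N ->
  dist_tv (glauber_mx R adj k) t <= rho ^+ t * (\sum_v w v) +
    2 * W * #|[set c | isp c & bad c]|%:R / #|{: coloring adj k}|%:R.
Proof.
move=> N0.
have N0' : (#|{: coloring adj k}|%:R : R) != 0 by rewrite pnatr_eq0 -lt0n.
apply: bigmax_le => [|i _].
  rewrite addr_ge0 ?divr_ge0 ?mulr_ge0 ?exprn_ge0 ?rho_ge0 //.
  by rewrite sumr_ge0 // => v _; rewrite (le_trans _ (w_ge1 v)).
pose N : R := #|{: coloring adj k}|%:R; rewrite -/N in N0' *.
set P := mxpow _ _.
(* The sign of [P i j - N^-1] is the test function attaining the L1 distance. *)
pose g c := if insub c is Some s then Num.sg (P i (enum_rank s) - N^-1) else 0.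
have gE j : g (val (enum_val j)) = Num.sg (P i j - N^-1) by rewrite /g valK enum_valK.
have g1 c : `|g c| <= 1.
  by rewrite /g; case: insub => [s|]; rewrite ?normr0 // normr_sg; case: (_ == 0).
have [e [He Se]] := iter_heat_bath_contract t g1.
have -> : \sum_j `|P i j - N^-1| = iter t T g (val (enum_val i)) - N^-1 * \sum_(c | isp c) g c.
  rewrite -mxpow_heat_bath // mxE -sum_coloring.
  rewrite [X in _ - _ * X](reindex _ (onW_bij _ (enum_val_bij _))) /=.
  rewrite mulr_sumr -sumrB; apply: eq_bigr => j _.
  by rewrite mxE gE normrEsg -/P; ring.
have statT : \sum_(c | isp c) iter t T g c = \sum_(c | isp c) g c.
  by move: g {gE g1 He Se} => g; elim: {P} t => //= s <-; rewrite heat_bath_stationary.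
have NE : N = \sum_(c | isp c) 1 by rewrite -sum_coloring sumr_const.
rewrite mulrC ler_pdivrMr // -statT.
set x := val (enum_val i); have px : isp x by exact: valP.
have -> : iter t T g x - N^-1 * \sum_(c | isp c) iter t T g c =
   N^-1 * \sum_(c | isp c) (iter t T g x - iter t T g c).
  by rewrite sumrB -[X in \sum_(c | isp c) X - _]mulr1 -mulr_sumr -NE; field.
rewrite mulrC ler_pdivrMr; last by rewrite lt_def N0' ler0n.
apply: (@le_trans _ _ (\sum_(c | isp c) (2 * rho ^+ t * (\sum_v w v) + e c))).
  apply: ler_sum => c pc; rewrite (le_trans (ler_norm _)) // (le_trans (He _ _ px pc)) //.
  rewrite lerD2r ler_wpM2l ?mulr_ge0 ?exprn_ge0 ?rho_ge0 //.
  apply: ler_sum => v _; rewrite ler_piMr ?(le_trans _ (w_ge1 v)) //.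
  by case: (_ != _).
rewrite big_split /= Se -[X in \sum_(c | isp c) X + _]mulr1 -mulr_sumr -NE.
have r1 : 1 - rho ^+ t <= 1 by rewrite gerBl exprn_ge0 ?rho_ge0.
set b : R := #|_|%:R; set D := \sum_v w v.
have -> : (rho ^+ t * D + 2 * W * b / N) * 2 * N = 2 * rho ^+ t * D * N + 2 * 1 * (2 * W * b) by field.
by rewrite lerD2l ler_wpM2r ?mulr_ge0 // ler_wpM2l.
Qed.
End Mixing.

(** * Colorings of the star and the colors available at its root *)

Section Star.
Context (R : realType) (b m : nat).
(** With this form [k - 1], [k - 2] and [k - 3] are [m.+2], [m.+1] and [m], free of truncated
    subtraction. *)
Local Notation k := m.+3.
Local Notation adj := (@star_adj b).
Local Notation isp := (@Defs.proper _ adj k).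
Implicit Types (f x y : {ffun 'I_b.+1 -> 'I_k}).

Lemma star_irr : irreflexive adj.
Proof. by move=> u; rewrite /star_adj eqxx. Qed.

Lemma star_sym : symmetric adj.
Proof. by move=> u v; rewrite /star_adj eq_sym. Qed.

Lemma sum_star_root (F : 'I_b.+1 -> nat) :
  (\sum_(u | adj ord0 u) F u = \sum_(i < b) F (lift ord0 i))%N.
Proof. by rewrite big_mkcond big_ord_recl /= add0n. Qed.

Lemma sum_star_leaf (F : 'I_b.+1 -> nat) i :
  (\sum_(u | adj (lift ord0 i) u) F u = F ord0)%N.
Proof. by rewrite big_mkcond big_ord_recl /= big1 ?addn0. Qed.

Lemma allowed_leaf f i : allowed adj f (lift ord0 i) = [set~ f ord0].
Proof.
apply/finset.setP => a; rewrite !inE; apply/forallP/idP => [/(_ ord0)|H u]; first by rewrite eq_sym.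
by case: (unliftP ord0 u) => [j ->|->] //=; rewrite eq_sym.
Qed.

Lemma card_allowed_leaf f i : #|allowed adj f (lift ord0 i)| = m.+2.
Proof. by rewrite allowed_leaf cardsC1 card_ord. Qed.

Lemma allowed_root f a : (a \in allowed adj f ord0) = [forall i : 'I_b, f (lift ord0 i) != a].
Proof.
rewrite inE; apply/forallP/forallP => H i; first by have := H (lift ord0 i).
by case: (unliftP ord0 i) => [j ->|->] //=; apply: H.
Qed.

Lemma star_proper f : isp f = [forall i : 'I_b, f (lift ord0 i) != f ord0].
Proof.
apply/proper_coloringP/forallP => [H i|H u v]; first exact: H.
case: (unliftP ord0 u) => [i ->|->]; case: (unliftP ord0 v) => [j ->|->] // _.
by rewrite eq_sym H.
Qed.

Definition star_weight (W : R) (v : 'I_b.+1) : R := if v == ord0 then W else 1.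

Definition crowded (W : R) f := #|allowed adj f ord0|%:R < 2 * W.

(** A root disagreement costs the leaves at most [b / (k - 1) <= W / 2], half its own weight. Leaf
    disagreements cost the root [W * h / #|A| <= h / 2] when [#|A| >= 2 * W], and at most [W]
    otherwise. *)
Lemma star_drift (W : R) x y : 0 < W -> 2 * b%:R / m.+2%:R <= W ->
  \sum_(v : 'I_b.+1) star_weight W v *
    Num.min 1 ((\sum_(u | adj v u) (x u != y u))%:R / #|allowed adj y v|%:R)
  <= wdist (star_weight W) x y / 2 + W * (crowded W y)%:R.
Proof.
move=> W0 bW; rewrite /wdist !big_ord_recl /star_weight /= sum_star_root.
under eq_bigr do rewrite sum_star_leaf card_allowed_leaf mul1r.
under [X in (_ + X) / 2]eq_bigr do rewrite mul1r.
rewrite -natr_sum; set r := (x ord0 != y ord0)%:R; set h := (\sum_(i < b) _)%:R.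
have r0 : 0 <= r by rewrite /r ler0n.
have h0 : 0 <= h :> R by rewrite ler0n.
have leaves : \sum_(i < b) Num.min 1 (r / m.+2%:R) <= W * r / 2 :> R.
  apply: (@le_trans _ _ (\sum_(i < b) (r / m.+2%:R))).
    by apply: ler_sum => i _; rewrite ge_min lexx orbT.
  rewrite sumr_const card_ord -[_ *+ _]mulr_natr.
  have M0 : m.+2%:R != 0 :> R by rewrite pnatr_eq0.
  have -> : r / m.+2%:R * b%:R = 2 * b%:R / m.+2%:R * (r / 2) :> R.
    by move: (m.+2%:R) M0 => M M0; field.
  by rewrite -[W * r / 2]mulrA ler_wpM2r // divr_ge0.
suff root : W * Num.min 1 (h / #|allowed adj y ord0|%:R) <= h / 2 + W * (crowded W y)%:R :> R.
  by rewrite mulrDl; lra.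
have [bd|] := boolP (crowded W y); rewrite /= ?mulr1 ?mulr0 ?addr0.
  rewrite -[X in X <= _]add0r lerD ?divr_ge0 // -[X in _ <= X]mulr1.
  by rewrite ler_pM2l // ge_min lexx.
rewrite /crowded -leNgt => A2.
have A0 : 0 < #|allowed adj y ord0|%:R :> R by rewrite (lt_le_trans _ A2) // mulr_gt0.
apply: (@le_trans _ _ (W * (h / #|allowed adj y ord0|%:R))).
  by rewrite ler_pM2l // ge_min lexx orbT.
rewrite mulrA ler_pdivrMr // -[h / 2 * _]mulrA [W * h]mulrC ler_wpM2l //.
by rewrite mulrC ler_pdivlMr // mulrC.
Qed.

Lemma sum_leaf_colors (c : 'I_k) (S : {set 'I_k}) n : #|S| = n ->
  \sum_(f : {ffun 'I_b.+1 -> 'I_k}) (f ord0 == c)%:R * \prod_(i < b) (f (lift ord0 i) \in S)%:R = n%:R ^+ b :> R.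
Proof.
move=> <-.
pose G (v : 'I_b.+1) (a : 'I_k) : R := if v == ord0 then (a == c)%:R else (a \in S)%:R.
transitivity (\prod_v \sum_a G v a).
  by rewrite bigA_distr_bigA; apply: eq_bigr => f _; rewrite big_ord_recl.
rewrite big_ord_recl /G /= natr_card.
under eq_bigr do rewrite natr_card.
rewrite prodr_const card_ord (_ : #|_| = 1%N) ?mul1r //.
by rewrite -(card1 c); apply: eq_card => a; rewrite inE.
Qed.

Lemma prod_natr_bool (I : finType) (P : pred I) :
  \prod_i (P i)%:R = [forall i, P i]%:R :> R.
Proof.
have [/forallP H|] := boolP [forall i, P i]; first by rewrite big1 // => i _; rewrite H.
rewrite negb_forall => /existsP[i /negPf Pi].
by rewrite (bigD1 i) //= Pi mul0r.
Qed.

(* [m.+2 = k - 1] colors differ from that of the root, which is itself always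
   allowed at the root and is not counted here. *)
Let spare f : R := \sum_(a | a != f ord0) (a \in allowed adj f ord0)%:R.

Lemma card_allowed_root f : isp f -> #|allowed adj f ord0|%:R = 1 + spare f.
Proof.
move=> pf; rewrite -(natr_card R) (bigD1 (f ord0)) //=.
by rewrite proper_allowed //; exact: star_sym.
Qed.

(** Conditions on the root color, after which the leaves choose independently. [F] takes that color
    as a separate argument so that it can be frozen to [c]. *)
Lemma sum_proper_star (F : 'I_k -> {ffun 'I_b.+1 -> 'I_k} -> R) :
  \sum_(f | isp f) F (f ord0) f =
  \sum_c \sum_(f : {ffun 'I_b.+1 -> 'I_k}) (f ord0 == c)%:R * (\prod_(i < b) (f (lift ord0 i) != c)%:R) * F c f.
Proof.
rewrite exchange_big big_mkcond; apply: eq_bigr => f _ /=.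
rewrite (bigD1 (f ord0)) //= eqxx mul1r [X in _ + X]big1 ?addr0.
  by rewrite prod_natr_bool star_proper; case: ifP => _; rewrite ?mul1r ?mul0r.
by move=> c /negPf; rewrite eq_sym => ->; rewrite !mul0r.
Qed.

Lemma card_star_coloring : #|{: coloring adj k}|%:R = k%:R * m.+2%:R ^+ b :> R.
Proof.
have -> : #|{: coloring adj k}|%:R = \sum_(f | isp f) 1 :> R.
  by rewrite -sum_coloring sumr_const.
rewrite (sum_proper_star (fun _ _ => 1)) -[in RHS](card_ord k) -natr_card.
rewrite mulr_suml; apply: eq_bigr => c _; rewrite inE mul1r.
have cS : #|[set~ c]| = m.+2 by rewrite cardsC1 card_ord.
rewrite -(sum_leaf_colors c cS); apply: eq_bigr => f _; rewrite mulr1.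
by congr (_ * _); apply: eq_bigr => i _; rewrite !inE.
Qed.

Lemma sum_spare1 : \sum_(f | isp f) spare f = k%:R * (m.+2%:R * m.+1%:R ^+ b).
Proof.
rewrite (sum_proper_star (fun c f => \sum_(a | a != c) (a \in allowed adj f ord0)%:R)).
rewrite -[in RHS](card_ord k) -natr_card mulr_suml; apply: eq_bigr => c _; rewrite inE mul1r.
under eq_bigr do rewrite mulr_sumr.
rewrite exchange_big /= (eq_bigr (fun=> m.+1%:R ^+ b)) => [|a ac].
  by rewrite sumr_const -[_ *+ _]mulr_natl cardC1 card_ord.
(* The color [a] is spare exactly when every leaf avoids both [c] and [a]. *)
have cS : #|~: [set c; a]| = m.+1 by rewrite cardsCs finset.setCK card_ord cards2 eq_sym ac.
rewrite -(sum_leaf_colors c cS); apply: eq_bigr => f _; rewrite -mulrA; congr (_ * _).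
rewrite allowed_root -prod_natr_bool -big_split; apply: eq_bigr => i _ /=.
by rewrite !inE negb_or -natrM mulnb.
Qed.

(** The square is expanded over pairs of colors: a diagonal pair leaves each leaf [m.+1] colors, an
    off-diagonal pair leaves it [m]. *)
Lemma sum_spare2 : \sum_(f | isp f) spare f ^+ 2 =
  k%:R * (m.+2%:R * (m.+1%:R ^+ b + m.+1%:R * m%:R ^+ b)).
Proof.
rewrite (sum_proper_star (fun c f => (\sum_(a | a != c) (a \in allowed adj f ord0)%:R) ^+ 2)).
rewrite -[in RHS](card_ord k) -natr_card mulr_suml; apply: eq_bigr => c _; rewrite inE mul1r.
under eq_bigr do rewrite expr2 mulr_suml mulr_sumr.
rewrite exchange_big /= (eq_bigr (fun=> m.+1%:R ^+ b + m.+1%:R * m%:R ^+ b)) => [|a ac].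
  by rewrite sumr_const -[_ *+ _]mulr_natl cardC1 card_ord.
under eq_bigr do rewrite mulr_sumr mulr_sumr.
rewrite exchange_big /= (bigD1 a) //=; congr (_ + _).
  have cS : #|~: [set c; a]| = m.+1 by rewrite cardsCs finset.setCK card_ord cards2 eq_sym ac.
  rewrite -(sum_leaf_colors c cS); apply: eq_bigr => f _; rewrite -mulrA; congr (_ * _).
  rewrite -natrM mulnb andbb allowed_root -prod_natr_bool -big_split; apply: eq_bigr => i _ /=.
  by rewrite !inE negb_or -natrM mulnb.
rewrite (eq_bigr (fun=> m%:R ^+ b)) => [|a' /andP[a'c a'a]].
  rewrite sumr_const -[_ *+ _]mulr_natl; congr (_%:R * _).
  have cS : #|~: [set c; a]| = m.+1 by rewrite cardsCs finset.setCK card_ord cards2 eq_sym ac.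
  by apply: etrans cS; apply: eq_card => a'; rewrite !inE negb_or.
have cS : #|~: (a' |: [set c; a])| = m.
  rewrite cardsCs finset.setCK card_ord cardsU1 cards2 !inE negb_or a'c a'a.
  by rewrite [c == a]eq_sym ac /= !subSS subn0.
rewrite -(sum_leaf_colors c cS); apply: eq_bigr => f _; rewrite -mulrA; congr (_ * _).
rewrite !allowed_root -!prod_natr_bool -!big_split; apply: eq_bigr => i _ /=.
by rewrite !inE !negb_or -!natrM !mulnb; case: (_ == c); case: (_ == a); case: (_ == a').
Qed.

(** Chebyshev's inequality: the variance of [spare] is at most its mean [mu], and a crowded coloring
    has [spare < 2 * W - 1 < mu / 2]. *)
Lemma crowded_rare (W : R) : let mu := m.+2%:R * (m.+1%:R / m.+2%:R) ^+ b in
  4 * W <= mu ->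
  #|[set f | isp f & crowded W f]|%:R <= 4 / mu * #|{: coloring adj k}|%:R :> R.
Proof.
move=> mu Wmu; set N : R := #|{: coloring adj k}|%:R.
have mu0 : 0 < mu by rewrite mulr_gt0 ?exprn_gt0 ?divr_gt0 ?ltr0n.
have M0 : m.+2%:R != 0 :> R by rewrite pnatr_eq0.
have E1 : \sum_(f | isp f) spare f = N * mu.
  rewrite sum_spare1 /N card_star_coloring /mu expr_div_n.
  by field; rewrite expf_neq0.
(* Negative correlation of the color indicators: [m * m.+2 <= m.+1 ^ 2]. *)
have E2 : \sum_(f | isp f) spare f ^+ 2 <= N * mu + N * mu ^+ 2.
  rewrite -E1 sum_spare1 sum_spare2 !mulrDr lerD2l /N card_star_coloring /mu -mulrA ler_pM2l ?ltr0n //.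
  rewrite expr_div_n; set x := m.+2%:R ^+ b; set y := m.+1%:R ^+ b; set z := m%:R ^+ b.
  have x0 : 0 < x by rewrite exprn_gt0 ?ltr0n.
  have -> : x * (m.+2%:R * (y / x)) ^+ 2 = m.+2%:R * (m.+2%:R * (y ^+ 2 / x)).
    by move: (m.+2%:R) => M; field; rewrite gt_eqF.
  rewrite ler_pM2l ?ltr0n //; apply: ler_pM; rewrite ?exprn_ge0 ?ler0n ?ler_nat //.
  rewrite ler_pdivlMr // /x /y /z -exprMn -exprM mulnC exprM.
  by rewrite lerXn2r ?nnegrE ?mulr_ge0 ?ler0n // -!natr1; nra.
have cheb : mu ^+ 2 / 4 * #|[set f | isp f & crowded W f]|%:R <=
    \sum_(f | isp f) (mu - spare f) ^+ 2.
  rewrite -sum1dep_card natr_sum mulr_sumr mulr1 big_mkcondr /=.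
  apply: ler_sum => f pf; case: ifP => [|_]; last exact: sqr_ge0.
  rewrite /crowded card_allowed_root // => cr.
  have -> : mu ^+ 2 / 4 = (mu / 2) ^+ 2 by field.
  by rewrite lerXn2r ?nnegrE; lra.
have N0 : 0 < N by rewrite /N card_star_coloring mulr_gt0 ?exprn_gt0 ?ltr0n.
have var : \sum_(f | isp f) (mu - spare f) ^+ 2 <= N * mu.
  have -> : \sum_(f | isp f) (mu - spare f) ^+ 2 =
      N * mu ^+ 2 - 2 * mu * (N * mu) + \sum_(f | isp f) spare f ^+ 2.
    have -> : N * mu ^+ 2 = \sum_(f | isp f) mu ^+ 2.
      rewrite /N -sum1_card natr_sum mulr_suml.
      rewrite -(@sum_coloring R _ adj k (fun=> mu ^+ 2)); apply: eq_bigr => f _; exact: mul1r.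
    rewrite -E1 mulr_sumr -sumrB -big_split; apply: eq_bigr => f _ /=.
    by ring.
  by move: E2; lra.
rewrite mulrAC ler_pdivlMr // -(ler_pM2r mu0).
by move: (le_trans cheb var); lra.
Qed.

End Star.

(** * Mixing time, eigenvalues and relaxation time *)

Section Spectrum.
Context (R : realType) (n : nat) (P : 'M[R]_n).

Lemma mixing_time_le t : dist_tv P t <= (2 * expR 1)^-1 -> (mixing_time P <= (t%:R)%:E)%E.
Proof.
move=> dt; rewrite /mixing_time; case: pselect => [h|]; last by case; exists t.
by case: ex_minnP => s _ smin; rewrite lee_fin ler_nat smin.
Qed.

Hypothesis P_stoch : P *m const_mx 1 = const_mx 1 :> 'cV_n.

Lemma ler_dist_tv t i : 2^-1 * \sum_(j < n) `|mxpow P t i j - (n%:R)^-1| <= dist_tv P t.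
Proof. exact: (le_bigmax _ (fun i => 2^-1 * \sum_(j < n) `|mxpow P t i j - (n%:R)^-1|)). Qed.

Lemma eigen_mxpow (v : 'rV_n) mu t : v *m P = mu *: v -> v *m mxpow P t = mu ^+ t *: v.
Proof.
move=> vP; elim: t => [|t IH]; first by rewrite mulmx1 scale1r.
by rewrite /mxpow iterS mulmxA IH -scalemxAl vP scalerA exprSr.
Qed.

(** For [mu != 1], stochasticity preserves the coordinate sum, so [(mu - 1)] times it is 0. For a
    repeated eigenvalue 1, the coordinate sum is one linear form on a space of dimension at least 2,
    so it has a nonzero kernel. *)
Lemma eigenvalue_zero_sum mu :
  eigenvalue P mu -> (mu != 1) || (1 < \rank (eigenspace P 1)%R)%N ->
  exists v : 'rV_n, [/\ v *m P = mu *: v, v != 0 & \sum_j v 0 j = 0].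
Proof.
move=> emu; have [-> /= r1|mu1 _] := eqVneq mu 1.
  set E := eigenspace P 1 in r1.
  have /rowV0Pn[v vK v0] : kermx (row_base E *m (const_mx 1 : 'cV_n)) != 0.
    rewrite kermx_eq0 /row_free; apply: contraTneq r1 => rE.
    by rewrite -leqNgt -{1}rE rank_leq_col.
  exists (v *m row_base E); split.
  - apply/eigenspaceP; apply: (submx_trans (submxMl _ _)).
    by rewrite eq_row_base.
  - by rewrite mulmx_free_eq0 // row_base_free.
  - move/sub_kermxP: vK; rewrite mulmxA => /matrixP/(_ 0 0); rewrite !mxE => vK.
    by rewrite -[RHS]vK; apply: eq_bigr => j _; rewrite [const_mx _ _ _]mxE mulr1.
move/eigenvalueP: emu => [v vP v0]; exists v; split=> //.
have : (v *m P) *m (const_mx 1 : 'cV_n) = v *m const_mx 1 by rewrite -mulmxA P_stoch.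
rewrite vP -scalemxAl => /matrixP/(_ 0 0); rewrite !mxE.
under eq_bigr do rewrite mxE mulr1.
move/eqP; rewrite -subr_eq0 -[X in _ - X]mul1r -mulrBl mulf_eq0 subr_eq0 (negPf mu1).
by move/eqP.
Qed.

(** A zero-sum left eigenvector kills the constant matrix [n%:R^-1], so it is also an eigenvector of
    the difference, whose rows have L1 norm at most [2 * dist_tv P t]. *)
Lemma eigenvalue_dist_tv mu t :
  eigenvalue P mu -> (mu != 1) || (1 < \rank (eigenspace P 1)%R)%N ->
  `|mu| ^+ t <= 2 * dist_tv P t.
Proof.
move=> emu hmu; have [v [vP v0 vs]] := eigenvalue_zero_sum emu hmu.
pose S := \sum_j `|v 0 j|.
have S0 : 0 < S.
  have [j vj] : exists j, v 0 j != 0 by apply/rV0Pn.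
  rewrite /S (bigD1 j) //= ltr_wpDr ?sumr_ge0 // normr_gt0 //.
rewrite -(ler_pM2r S0) /S mulr_sumr.
apply: (@le_trans _ _ (\sum_j \sum_i `|v 0 i| * `|mxpow P t i j - n%:R^-1|)).
  apply: ler_sum => j _; rewrite -normrX -normrM.
  have -> : mu ^+ t * v 0 j = \sum_i v 0 i * (mxpow P t i j - n%:R^-1).
    under eq_bigr do rewrite mulrBr.
    rewrite sumrB -mulr_suml vs mul0r subr0.
    by have /matrixP/(_ 0 j) := eigen_mxpow t vP; rewrite !mxE.
  by apply: (le_trans (ler_norm_sum _ _ _)); apply: ler_sum => i _; rewrite normrM.
rewrite exchange_big mulr_sumr /=; apply: ler_sum => i _.
rewrite -mulr_sumr mulrC ler_wpM2r //.
by rewrite -ler_pdivrMl // ler_dist_tv.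
Qed.

(* [2 * dist_tv P t <= 1 / e <= 1 / 2] bounds [`|mu| ^+ t], and Bernoulli's
   inequality turns this into a gap of at least [1 / (2 t)]. *)
Lemma relaxation_time_le t : (0 < t)%N ->
  dist_tv P t <= (2 * expR 1)^-1 -> (relaxation_time P <= (2 * t%:R)%:E)%E.
Proof.
move=> t0 dt.
have T0 : (0 : R) < 2 * t%:R by rewrite mulr_gt0 ?ltr0n.
have T1 : (2 * t%:R : R)^-1 <= 1.
  by rewrite invf_le1 // -natrM ler1n muln_gt0.
suff L : lambda_star P <= 1 - (2 * t%:R)^-1.
  have L1 : lambda_star P < 1 by rewrite (le_lt_trans L) // gtrBl invr_gt0.
  rewrite /relaxation_time L1 lee_fin invf_ple ?posrE // ?subr_gt0 //.
  by rewrite lerBrDr -lerBrDl.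
rewrite /lambda_star; set A := [set `|mu| | mu in _]%classic.
have ub x : A x -> x <= 1 - (2 * t%:R)^-1.
  move=> [mu /= /andP[emu hmu] <-].
  have := eigenvalue_dist_tv t emu hmu; rewrite leNgt => /negP H; rewrite leNgt; apply/negP => lt.
  apply: H.
  apply: (@le_lt_trans _ _ 2^-1).
    apply: (@le_trans _ _ (2 * (2 * expR 1)^-1)); first by rewrite ler_pM2l.
    rewrite invfM mulrA divff // mul1r lef_pV2 ?posrE ?expR_gt0 //.
    by rewrite (le_trans _ (expR_ge1Dx _)).
  apply: (@le_lt_trans _ _ ((1 - (2 * t%:R)^-1) ^+ t)); last first.
    by rewrite ltrXn2r -?lt0n // ?subr_ge0.
  have B (s : R) : 0 <= s -> s <= 1 -> 1 - s *+ t <= (1 - s) ^+ t.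
    move=> s0 s1; elim: t {t0 dt T0 T1 lt} => [|r IH]; first by rewrite subr0.
    rewrite exprS; apply: (@le_trans _ _ ((1 - s) * (1 - s *+ r))).
      rewrite mulrSr; have : 0 <= s * (s *+ r) by rewrite mulr_ge0 ?mulrn_wge0.
      by move: (s *+ r) => q; nra.
    by rewrite ler_wpM2l ?subr_ge0.
  apply: (le_trans _ (B _ _ T1)); last by rewrite invr_ge0 ltW.
  rewrite -[_ *+ t]mulr_natr invfM -mulrA mulVf ?pnatr_eq0 -?lt0n //.
  lra.
(* The supremum of the empty set is 0 by convention, which also satisfies the bound. *)
have [A0|A0] := pselect (A !=set0)%classic; first exact: ge_sup.
by rewrite (_ : A = set0) ?sup0 ?subr_ge0 //; apply/nonemptyPn.
Qed.

End Spectrum.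

(** * Estimates for large [b] *)

Section Asymptotics.
Context (R : realType).

Lemma expR1_le4 : expR 1 <= 4 :> R.
Proof.
have h : 2^-1 <= expR (- 2^-1) :> R by apply: le_trans (expR_ge1Dx _); lra.
have -> : expR 1 = (expR (- 2^-1) * expR (- 2^-1))^-1 :> R.
  by rewrite -expRD -expRN; congr expR; field.
rewrite -[X in _ <= X]invrK lef_pV2 ?posrE ?invr_gt0 ?mulr_gt0 ?expR_gt0 //.
have -> : (4^-1 : R) = 2^-1 * 2^-1 by field.
by rewrite ler_pM.
Qed.

Lemma expR_cube_ge (x : R) : 0 <= x -> (x / 3) ^+ 3 <= expR x.
Proof.
move=> x0; have -> : expR x = expR (x / 3) ^+ 3.
  by rewrite -expRM_natl; congr expR; field.
rewrite lerXn2r ?nnegrE ?expR_ge0 ?divr_ge0 //.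
by rewrite (le_trans _ (expR_ge1Dx _)) // lerDr.
Qed.

(* With [k >= D b / L + 2] and [d = 1 - 1 / D], mu is at least [exp (d L) / L] and
   [W <= 3 L]; the third summand of [L0] makes [(d L / 3) ^ 3] exceed [384 L ^ 2]. *)
Lemma mean_spare_colors_ge (C : R) : 1 < C -> exists L0 : R, 64 <= L0 /\
  forall b k : nat, expR L0 < b%:R -> C * b%:R / ln (b%:R : R) <= k%:R ->
  exists2 m, k = m.+3 &
    128 * (1 + 2 * b%:R / m.+2%:R) <= m.+2%:R * (m.+1%:R / m.+2%:R) ^+ b :> R.
Proof.
move=> C1.
pose D := (1 + C) / 2; pose d := 1 - D^-1.
have D1 : 1 < D by rewrite /D; lra.
have D0 : 0 < D by rewrite (lt_trans ltr01).
have d0 : 0 < d by rewrite subr_gt0 invf_lt1.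
have d3 : 0 < d ^+ 3 by rewrite exprn_gt0.
have c1 : 0 < C - 1 by rewrite subr_gt0.
(* The second summand makes [L * (C - 1) > 16], so that lowering [C] to [D] pays for the extra 2 in
   [kD]; this uses [b >= L ^+ 2 / 4]. *)
exists (64 + 16 / (C - 1) + 27 * (384 / d ^+ 3)).
have q1 : 0 < 16 / (C - 1) by rewrite divr_gt0.
have q2 : 0 < 27 * (384 / d ^+ 3) by rewrite mulr_gt0 ?divr_gt0 ?ltr0n.
split=> [|b k]; first by lra.
set L0 := (_ + _ + _) => bL0; set L := ln _ => Ck.
have b0 : 0 < b%:R :> R by rewrite (lt_trans _ bL0) ?expR_gt0.
have LL : L0 < L by rewrite -ltr_expR lnK.
have bE : b%:R = expR L by rewrite lnK.
have L1 : 64 < L by rewrite (le_lt_trans _ LL) // /L0; lra.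
have Lp : 0 < L by lra.
have Lc : 16 < L * (C - 1).
  by rewrite -ltr_pdivrMr // (le_lt_trans _ LL) // /L0; lra.
have Ld : 27 * 384 < L * d ^+ 3.
  by rewrite -ltr_pdivrMr // -mulrA (le_lt_trans _ LL) // /L0; lra.
have bL : L ^+ 2 / 4 <= b%:R.
  have -> : b%:R = expR (L / 2) ^+ 2 by rewrite bE -expRM_natl; congr expR; field.
  have -> : L ^+ 2 / 4 = (L / 2) ^+ 2 by field.
  rewrite lerXn2r ?nnegrE ?expR_ge0 ?divr_ge0 // ?(ltW Lp) //.
  by rewrite (le_trans _ (expR_ge1Dx _)) // lerDr.
have kD : D * b%:R / L + 2 <= k%:R.
  apply: le_trans Ck; rewrite -(ler_pM2r Lp) mulrDl !divfK ?gt_eqF // /D.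
  have : (C - 1) * (L ^+ 2 / 4) <= (C - 1) * b%:R by rewrite ler_pM2l.
  have : 16 * L <= L * (C - 1) * L by rewrite ler_pM2r // ltW.
  by rewrite expr2; nra.
have k3 : (2 < k)%N.
  rewrite -(ltr_nat R); apply: lt_le_trans kD.
  by rewrite ltrDr divr_gt0 // mulr_gt0.
case: k Ck kD k3 => [|[|[|m]]] // Ck kD _; exists m => //.
have m1 : 0 < m.+1%:R :> R by rewrite ltr0n.
have m2 : 0 < m.+2%:R :> R by rewrite ltr0n.
have mD : D * b%:R / L <= m.+1%:R.
  by move: kD; rewrite -[m.+3%:R]natr1 -[m.+2%:R]natr1; lra.
have mD2 : D * b%:R / L <= m.+2%:R by rewrite (le_trans mD) // ler_nat.
have bm : b%:R / m.+1%:R <= L / D.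
  rewrite ler_pdivrMr // mulrAC ler_pdivlMr //.
  by move: mD; rewrite ler_pdivrMr //; lra.
(* [m.+2 / m.+1 = 1 + 1 / m.+1 <= exp (1 / m.+1)], inverted and raised to the power [b]. *)
have ratio : expR (- (L / D)) <= (m.+1%:R / m.+2%:R) ^+ b.
  apply: (@le_trans _ _ (expR (- (m.+1%:R^-1)) ^+ b)).
    by rewrite -expRM_natl ler_expR mulrN lerN2.
  rewrite lerXn2r ?nnegrE ?expR_ge0 ?divr_ge0 ?ler0n //.
  rewrite expRN -[X in _ <= X]invf_div lef_pV2 ?posrE ?expR_gt0 ?divr_gt0 //.
  apply: le_trans (expR_ge1Dx _).
  by rewrite -[m.+2%:R]natr1 mulrDl divff ?gt_eqF // mul1r.
have Wle : 1 + 2 * b%:R / m.+2%:R <= 3 * L.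
  have : b%:R / m.+2%:R <= L.
    rewrite ler_pdivrMr // mulrC -ler_pdivrMr // (le_trans _ mD2) //.
    by rewrite ler_pM2r ?invr_gt0 // ler_peMl // ltW.
  by rewrite -[2 * _ / _]mulrA; move: (b%:R / _) => q; lra.
apply: (@le_trans _ _ (128 * (3 * L))); first by rewrite ler_pM2l.
apply: (@le_trans _ _ (expR (d * L) / L)); last first.
  apply: (@le_trans _ _ (D * b%:R / L * expR (- (L / D)))); last first.
    apply: ler_pM => //.
    exact: divr_ge0 (mulr_ge0 (ltW D0) (ltW b0)) (ltW Lp).
  rewrite [X in _ <= X]mulrAC ler_pM2r ?invr_gt0 // bE -mulrA -expRD.
  have -> : L + - (L / D) = d * L by rewrite /d; field; rewrite gt_eqF.
  by rewrite ler_peMl ?expR_ge0 // ltW.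
rewrite ler_pdivlMr //.
apply: (le_trans _ (expR_cube_ge _)); last by rewrite mulr_ge0 // ltW.
have -> : (d * L / 3) ^+ 3 = L * d ^+ 3 * L ^+ 2 / 27 by field.
have L2 : 0 < L ^+ 2 by rewrite exprn_gt0.
have : 27 * 384 * L ^+ 2 <= L * d ^+ 3 * L ^+ 2 by rewrite ler_pM2r // ltW.
by rewrite -[128 * (3 * L) * L]mulrA -[3 * L * L]mulrA -expr2; lra.
Qed.

(** The budget is [1 / 8 <= 1 / (2 e)], split in two halves. After [t] steps [rho ^ t <= b ^ -2]
    against a total weight of at most [4 b], and the crowded term is at most
    [8 W / mu <= 8 / 128]. *)
Lemma dist_tv_star (b m t : nat) :
  64 <= b%:R :> R -> 4 * (b%:R + 1) * ln (b%:R : R) <= t%:R ->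
  128 * (1 + 2 * b%:R / m.+2%:R) <= m.+2%:R * (m.+1%:R / m.+2%:R) ^+ b :> R ->
  dist_tv (glauber_mx R (@star_adj b) m.+3) t <= (2 * expR 1)^-1.
Proof.
move=> b64 tL; set mu := m.+2%:R * _ => Wmu.
pose W : R := 1 + 2 * b%:R / m.+2%:R.
have b0 : 0 < b%:R :> R by lra.
have m2 : 1 <= m.+2%:R :> R by rewrite ler1n.
have q0 : 0 <= 2 * b%:R / m.+2%:R :> R by rewrite divr_ge0 ?mulr_ge0.
have W1 : 1 <= W by rewrite lerDl.
have W0 : 0 < W by lra.
have mu0 : 0 < mu by apply: lt_le_trans Wmu; rewrite mulr_gt0.
have Wb : W <= 3 * b%:R.
  have : 2 * b%:R / m.+2%:R <= 2 * b%:R :> R.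
    by rewrite ler_pdivrMr ?ltr0n // ler_peMr ?mulr_ge0.
  by rewrite /W; move: (_ / _) => q; lra.
have N0 : (0 < #|{: coloring (@star_adj b) m.+3}|)%N.
  by rewrite -(ltr0n R) card_star_coloring mulr_gt0 ?exprn_gt0 ?ltr0n.
have w1 (v : 'I_b.+1) : 1 <= star_weight W v by rewrite /star_weight; case: ifP.
have W2 : 2 * b%:R / m.+2%:R <= W by rewrite lerDr.
have := @dist_tv_glauber R _ _ m.+3 (@star_irr b) (@star_sym b) _ _ W (crowded W)
  (ltW W0) w1 (fun x y _ _ => star_drift x y W0 W2) t N0.
rewrite card_ord => /(_ (ltn0Sn _)) H; apply: (le_trans H).
have sw : \sum_(v : 'I_b.+1) star_weight W v = W + b%:R :> R.
  by rewrite big_ord_recl /star_weight /= sumr_const card_ord.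
have rare : 2 * W * #|[set c : {ffun 'I_b.+1 -> 'I_m.+3} | Defs.proper (@star_adj b) c & crowded W c]|%:R
    / #|{: coloring (@star_adj b) m.+3}|%:R <= 16^-1.
  rewrite ler_pdivrMr ?ltr0n //.
  apply: (@le_trans _ _ (2 * W * (4 / mu * #|{: coloring (@star_adj b) m.+3}|%:R))).
    rewrite ler_pM2l ?mulr_gt0 //; apply: crowded_rare; rewrite -/mu.
    by apply: le_trans Wmu; rewrite ler_pM2r // ler_nat.
  rewrite mulrA ler_wpM2r // mulrA ler_pdivrMr //.
  by move: Wmu; rewrite -/W; lra.
have rho0 : 0 <= 1 - (2 * b.+1%:R)^-1 :> R.
  by rewrite subr_ge0 invf_le1 ?mulr_gt0 ?ltr0n // -natrM ler1n.
have decay : (1 - (2 * b.+1%:R)^-1) ^+ t <= (b%:R ^+ 2)^-1 :> R.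
  have b1 : 0 < 2 * b.+1%:R :> R by rewrite mulr_gt0 ?ltr0n.
  apply: (@le_trans _ _ (expR (- (2 * b.+1%:R)^-1) ^+ t)).
    by rewrite lerXn2r ?nnegrE ?expR_ge0 ?expR_ge1Dx.
  rewrite -[X in _ <= (X ^+ 2)^-1](lnK (_ : b%:R \is Num.pos)) ?posrE //.
  rewrite -!expRM_natl -expRN ler_expR mulrN lerN2 ler_pdivlMr //.
  by move: tL; rewrite -natr1; lra.
apply: (@le_trans _ _ (8^-1)); last first.
  by rewrite lef_pV2 ?posrE ?mulr_gt0 ?expR_gt0 //; have : expR 1 <= 4 :> R := expR1_le4; lra.
have : (1 - (2 * b.+1%:R)^-1) ^+ t * \sum_(v : 'I_b.+1) star_weight W v <= 16^-1.
  rewrite sw; apply: (@le_trans _ _ ((b%:R ^+ 2)^-1 * (4 * b%:R))).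
    apply: ler_pM => //; [exact: exprn_ge0 | lra | lra].
  have -> : (b%:R ^+ 2)^-1 * (4 * b%:R) = 4 / b%:R :> R by field; rewrite gt_eqF.
  by rewrite ler_pdivrMr //; lra.
by move: rare; lra.
Qed.

End Asymptotics.

(** * Mixing and relaxation in time of order [b ln b] *)

Unset Implicit Arguments.

Theorem theorem5 (R : realType) (C : R) :
  1 < C ->
  exists b0 : R, 0 < b0 /\
  exists c : R, 0 < c /\
  forall b k : nat,
    b0 < b%:R ->
    C * b%:R / ln (b%:R : R) <= k%:R ->
    (mixing_time (glauber_mx R (@star_adj b) k) <= (c * (b%:R * ln (b%:R : R)))%:E)%E /\
    (relaxation_time (glauber_mx R (@star_adj b) k) <= (c * (b%:R * ln (b%:R : R)))%:E)%E.
Proof.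
move=> C1; have [L0 [L64 spare]] := mean_spare_colors_ge C1.
exists (expR L0); split; first exact: expR_gt0.
(* Twice 9: the relaxation time is at most [2 t] with [t <= 9 * (b * L)]. *)
exists 18; split=> // b k b_big Ck.
have [m -> mu] := spare b k b_big Ck.
set L := ln _.
have b0 : 0 < b%:R :> R by rewrite (lt_trans _ b_big) ?expR_gt0.
have L0L : L0 < L by rewrite -ltr_expR lnK.
have b64 : 64 <= b%:R :> R.
  by rewrite (le_trans _ (ltW b_big)) // (le_trans _ (expR_ge1Dx _)) //; lra.
have bL0 : 0 <= 9 * (b%:R * L) by rewrite !mulr_ge0 //; lra.
have bL1 : 64 * L <= b%:R * L by rewrite ler_wpM2r //; lra.
(* The factor 9 leaves room for [4 * (b + 1) * L] after rounding down. *)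
pose t := Num.truncn (9 * (b%:R * L)).
have /andP[t_le t_gt] : t%:R <= 9 * (b%:R * L) < t.+1%:R by exact: truncn_itv.
have t_ge : 4 * (b%:R + 1) * L <= t%:R.
  by move: t_gt; rewrite -natr1; lra.
have t0 : (0 < t)%N.
  by rewrite -(ltr0n R) (lt_le_trans _ t_ge) // !mulr_gt0 //; lra.
have mix := dist_tv_star b64 t_ge mu.
split; first by apply: (le_trans (mixing_time_le mix)); rewrite lee_fin; lra.
apply: (le_trans (relaxation_time_le _ t0 mix)); last by rewrite lee_fin; lra.
apply: glauber_mx_stochastic; [exact: star_irr | exact: star_sym | by rewrite card_ord].
Qed.
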